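(* Let $K$ be a field, let $S=K[x_1,\ldots,x_n]$, let $1\leq q\leq n$, and let $I_q\subset S$ be the ideal generated by all square-free monomials of degree $q$ in $x_1,\ldots,x_n$. Then $$\operatorname{type}(S/I_q)=\binom{n-1}{n-q}.$$
   Context: The ring $S/I_q$ is Cohen-Macaulay (a known fact). For a Cohen-Macaulay standard graded $K$-algebra $S/I$ (with $I$ a graded ideal of the polynomial ring $S$), $\operatorname{type}(S/I)$ denotes its Cohen-Macaulay type, which equals the last nonzero Betti number (the rank of the last nonzero free module) in the minimal graded free resolution of $S/I$ as an $S$-module. *)

(* Defs.v *)
From HB Require Import structures.
From mathcomp Require Import all_boot all_order all_algebra.
From mathcomp Require Import mpoly.
From Stdlib Require Import ClassicalEpsilon.

Set Implicit Arguments.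
Unset Strict Implicit.
Unset Printing Implicit Defensive.

Import GRing.Theory.
Local Open Scope ring_scope.

Definition ideal_gen (R : comNzRingType) (G : R -> Prop) (f : R) : Prop :=
  exists (k : nat) (c g : 'I_k -> R),
    (forall j, G (g j)) /\ f = \sum_(j < k) c j * g j.

Definition squarefree_monomial (K : fieldType) (n q : nat)
    (g : {mpoly K[n]}) : Prop :=
  exists m : 'X_{1..n},
    [/\ forall i : 'I_n, (m i <= 1)%N, mdeg m = q & g = 'X_[m]].

Definition squarefree_veronese (K : fieldType) (n q : nat) :
    {mpoly K[n]} -> Prop :=
  ideal_gen (@squarefree_monomial K n q).

Arguments squarefree_veronese K n q : clear implicits.

(* A sequence of graded free modules and maps
     ... -> F_2 -> F_1 -> F_0 -> S,   S = K[x_1, ..., x_n],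
   where F_i is the direct sum of the S(- fr_shift i a), a < fr_rank i.
   Elements of F_i are row vectors, on which matrices act on the right.
   [fr_aug] lifts to S the augmentation F_0 -> S/I. *)
Record free_sequence (K : fieldType) (n : nat) := FreeSequence {
  fr_rank : nat -> nat;
  fr_shift : forall i, 'I_(fr_rank i) -> int;
  fr_map : forall i, 'M[{mpoly K[n]}]_(fr_rank i.+1, fr_rank i);
  fr_aug : 'cV[{mpoly K[n]}]_(fr_rank 0)
}.

(* All maps are homogeneous of degree 0: the entry of a map S(-a) -> S(-b) is
   a form of degree a - b, hence is 0 when a < b. *)
Definition graded_maps (K : fieldType) (n : nat)
    (F : free_sequence K n) : Prop :=
  (forall i (a : 'I_(fr_rank F i.+1)) (b : 'I_(fr_rank F i)),
     forall m, m \in msupp (fr_map F i a b) ->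
       (mdeg m)%:Z = fr_shift a - fr_shift b)
  /\ (forall a : 'I_(fr_rank F 0),
     forall m, m \in msupp (fr_aug F a 0) -> (mdeg m)%:Z = fr_shift a).

(* Exactness of ... -> F_1 -> F_0 -> S/I -> 0. *)
Definition resolves_quotient (K : fieldType) (n : nat)
    (I : {mpoly K[n]} -> Prop) (F : free_sequence K n) : Prop :=
  [/\ forall f : {mpoly K[n]},
        exists v : 'rV_(fr_rank F 0), I (f - (v *m fr_aug F) 0 0),
      forall v : 'rV_(fr_rank F 0),
        I ((v *m fr_aug F) 0 0) <-> exists w, v = w *m fr_map F 0
    & forall i (v : 'rV_(fr_rank F i.+1)),
        v *m fr_map F i = 0 <-> exists w, v = w *m fr_map F i.+1].

(* The image of F_(i+1) lies in (x_1, ..., x_n) F_i: no entry of the matrix has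
   a constant term. *)
Definition minimal_maps (K : fieldType) (n : nat)
    (F : free_sequence K n) : Prop :=
  forall i (a : 'I_(fr_rank F i.+1)) (b : 'I_(fr_rank F i)),
    (fr_map F i a b)@_0%MM = 0.

Definition minimal_graded_free_resolution (K : fieldType) (n : nat)
    (I : {mpoly K[n]} -> Prop) (F : free_sequence K n) : Prop :=
  [/\ graded_maps F, resolves_quotient I F & minimal_maps F].

Definition last_nonzero_rank (K : fieldType) (n : nat)
    (F : free_sequence K n) (t : nat) : Prop :=
  exists p : nat,
    [/\ fr_rank F p = t, (0 < t)%N
      & forall i, (p < i)%N -> fr_rank F i = 0%N].

(* The Cohen-Macaulay type of S/I, for S/I Cohen-Macaulay, as its last nonzero
   Betti number.  A minimal graded free resolution is unique up to isomorphism,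
   so at most one t satisfies the description; the value is meaningful when
   I is a proper graded ideal. *)
Definition cm_type (K : fieldType) (n : nat)
    (I : {mpoly K[n]} -> Prop) : nat :=
  epsilon (inhabits 0%N) (fun t => exists F : free_sequence K n,
    minimal_graded_free_resolution I F /\ last_nonzero_rank F t).

(* Main.v *)
Require Import Defs.
From mathcomp Require Import all_boot all_order all_algebra.
From mathcomp Require Import mpoly.
From Stdlib Require Import ClassicalEpsilon.
From mathcomp Require Import zify.

Import GRing.Theory.

(** Why the formula holds.

    Number the variables of S from 0, so that x_k follows the first k of them.
    Write I(k, q) for the ideal of S generated by the square-free monomials of
    degree q in the first k variables. A polynomial lies in I(k, q) exactly
    when each of its monomials involves at least q of the first k variables,
    and sorting the monomials of I(k+1, q+1) by whether x_k is needed gives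

      I(k+1, q+1) = I(k, q+1) + x_k I(k, q)      [support_idealS].

    Since I(k, q+1) is contained in I(k, q), and x_k is a nonzerodivisor modulo
    I(k, q+1), the two summands meet exactly in x_k I(k, q+1): there is a short
    exact sequence

      0 -> I(k, q+1)(-1) -> I(k, q+1) + I(k, q)(-1) -> I(k+1, q+1) -> 0

    with a direct sum in the middle. A resolution of I(k+1, q+1) is therefore
    the mapping cone [cone_resolves] of a comparison map lifting multiplication
    by x_k on the first summand and the inclusion, up to sign, on the second.
    Inductively I(k, q) has a q-linear resolution: generators in degree q, and
    maps whose entries are linear forms. Lifting the inclusion by linear forms
    [linear_comparison] keeps the cone linear, and a linear resolution is
    automatically minimal. Counting ranks in the cone turns into Pascal's rule
    and yields the Betti numbers C(k, q+i) C(q+i-1, i)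
    [veronese_resolution]. For k = n the last nonzero one has i = n - q and
    equals C(n-1, n-q); adjoining S in degree 0 resolves S/I_q
    [quotient_resolution].

    As [cm_type] selects a value through an arbitrary minimal resolution, the
    other half of the proof is that the ranks do not depend on that choice
    [minimal_rank_le]. Two resolutions admit comparison maps in both
    directions; their composite is homotopic to the identity, and for a minimal
    resolution the homotopy terms vanish modulo the variables. There the
    composite is thus the identity matrix, which bounds one rank
    by the other. *)

(** * Lifting through exact sequences and uniqueness of Betti numbers *)

Section ChainMaps.
Set Implicit Arguments.
Unset Strict Implicit.
Unset Printing Implicit Defensive.
Local Open Scope ring_scope.

(** The invariant that is carried along is that the current term has a
    successor; so both chain maps and homotopies, whose next term depends on
    the whole previous equation, can be built from one step. *)
Lemma dependent_choice_from (T : nat -> Type) (R : forall i, T i -> T i.+1 -> Prop)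
    (x0 : T 0%N) :
  (exists y, R 0%N x0 y) ->
  (forall i x y, R i x y -> exists z, R i.+1 y z) ->
  exists f : forall i, T i, f 0%N = x0 /\ forall i, R i (f i) (f i.+1).
Proof.
move=> h0 hS.
pose U i := {x : T i | exists y, R i x y}.
pose next i (u : U i) := constructive_indefinite_description _ (proj2_sig u).
pose step i (u : U i) : U i.+1 :=
  exist _ (proj1_sig (next i u)) (hS _ _ _ (proj2_sig (next i u))).
pose f := nat_rect U (exist _ x0 h0) step.
exists (fun i => proj1_sig (f i)); split=> // i.
exact: (proj2_sig (next i (f i))).
Qed.

Lemma factor_rows (R : comNzRingType) r s t (A : 'M[R]_(r, t)) (E : 'M[R]_(s, t)) :
  (forall i, exists w, row i A = w *m E) -> exists Y, A = Y *m E.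
Proof.
move=> h; have [w hw] := fin_all_exists h.
exists (\matrix_i w i); apply/row_matrixP=> i.
by rewrite row_mul rowK hw.
Qed.

Definition exact_maps (K : fieldType) n (F : free_sequence K n) : Prop :=
  forall i (v : 'rV_(fr_rank F i.+1)),
    v *m fr_map F i = 0 <-> exists w, v = w *m fr_map F i.+1.

Lemma exact_factor (K : fieldType) n (F : free_sequence K n) :
  exact_maps F -> forall i r (A : 'M_(r, _)),
  A *m fr_map F i = 0 -> exists Y, A = Y *m fr_map F i.+1.
Proof.
move=> exF i r A A0; apply: factor_rows => j; apply/exF.
by rewrite -row_mul A0 row0.
Qed.

Lemma exact_map_comp (K : fieldType) n (F : free_sequence K n) :
  exact_maps F -> forall i, fr_map F i.+1 *m fr_map F i = 0.
Proof.
move=> exF i; apply/row_matrixP=> j; rewrite row_mul row0.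
by apply/exF; exists (delta_mx 0 j); rewrite -rowE.
Qed.

(** The degree 0 term is prescribed, which serves the comparison of ideals as
    well as that of quotients, where it is found in different ways. *)
Lemma extend_chain_map (K : fieldType) n (F G : free_sequence K n)
    (phi0 : 'M_(fr_rank F 0, fr_rank G 0)) :
  exact_maps F -> exact_maps G ->
  (exists y, fr_map F 0 *m phi0 = y *m fr_map G 0) ->
  exists phi : forall i, 'M_(fr_rank F i, fr_rank G i),
    phi 0%N = phi0 /\
    forall i, fr_map F i *m phi i = phi i.+1 *m fr_map G i.
Proof.
move=> exF exG h0.
apply: (dependent_choice_from
  (R := fun i x y => fr_map F i *m x = y *m fr_map G i)) => // i x y e.
apply: exact_factor exG _ _ _ _.
by rewrite -mulmxA -e mulmxA exact_map_comp // mul0mx.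
Qed.

(** A chain endomorphism of an exact sequence is determined up to homotopy by
    what it induces at the end of the sequence: the obstruction to extending
    the homotopy by one step is a cycle, so it is a boundary. *)
Lemma null_homotopy (K : fieldType) n (F : free_sequence K n)
    (delta : forall i, 'M_(fr_rank F i))
    (h0 : 'M_(fr_rank F 0, fr_rank F 1)) :
  exact_maps F ->
  (forall i, fr_map F i *m delta i = delta i.+1 *m fr_map F i) ->
  delta 0%N = h0 *m fr_map F 0 ->
  exists h : forall i, 'M_(fr_rank F i, fr_rank F i.+1),
    h 0%N = h0 /\
    forall i, delta i.+1 = fr_map F i *m h i + h i.+1 *m fr_map F i.+1.
Proof.
move=> exF dd d0.
apply: (dependent_choice_from
  (R := fun i x y => delta i.+1 = fr_map F i *m x + y *m fr_map F i.+1)).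
  have [|y hy] := exact_factor exF (i := 0) (A := delta 1%N - fr_map F 0 *m h0).
    by rewrite mulmxBl -dd d0 mulmxA subrr.
  by exists y; rewrite -hy addrC subrK.
move=> i x y e.
have [|z hz] := exact_factor exF (i := i.+1) (A := delta i.+2 - fr_map F i.+1 *m y).
  rewrite mulmxBl -dd e mulmxDr !mulmxA exact_map_comp // mul0mx add0r.
  by rewrite subrr.
by exists z; rewrite -hz addrC subrK.
Qed.

Definition is_ideal (R : comNzRingType) (I : R -> Prop) : Prop :=
  [/\ I 0, forall f g, I f -> I g -> I (f + g) & forall c f, I f -> I (c * f)].

Lemma ideal_sum (R : comNzRingType) (I : R -> Prop) (T : finType) (f : T -> R) :
  is_ideal I -> (forall j, I (f j)) -> I (\sum_j f j).
Proof.
by case=> I0 ID _ hf; apply: (big_ind I).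
Qed.

Lemma ideal_mulmx (R : comNzRingType) (I : R -> Prop) r s t
    (A : 'M[R]_(r, s)) (B : 'M[R]_(s, t)) :
  is_ideal I -> (forall i j, I (B i j)) -> forall i j, I ((A *m B) i j).
Proof.
move=> idI hB i j; rewrite mxE; apply: ideal_sum => // k.
by case: idI => _ _; apply.
Qed.

Lemma ideal_addmx (R : comNzRingType) (I : R -> Prop) r s
    (A B : 'M[R]_(r, s)) :
  is_ideal I -> (forall i j, I (A i j)) -> (forall i j, I (B i j)) ->
  forall i j, I ((A + B) i j).
Proof. by case=> _ ID _ hA hB i j; rewrite mxE; apply: ID. Qed.

Section MinimalResolutions.
Variables (K : fieldType) (n : nat) (I : {mpoly K[n]} -> Prop).
Hypothesis idI : is_ideal I.

Lemma aug_factor (F : free_sequence K n) r (A : 'M_(r, _)) :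
  resolves_quotient I F -> (forall i j, I ((A *m fr_aug F) i j)) ->
  exists Y, A = Y *m fr_map F 0.
Proof.
case=> _ ex0 _ hA; apply: factor_rows => i; apply/ex0.
by rewrite -row_mul mxE; apply: hA.
Qed.

Lemma map_aug_in_ideal (F : free_sequence K n) :
  resolves_quotient I F -> forall i j, I ((fr_map F 0 *m fr_aug F) i j).
Proof.
case=> _ ex0 _ i j; rewrite ord1.
have /ex0 : exists w, row i (fr_map F 0) = w *m fr_map F 0.
  by exists (delta_mx 0 i); rewrite -rowE.
by rewrite -row_mul mxE.
Qed.

(** Over S the lift of the identity of S/I commutes with the augmentations only
    modulo I; exactness at the degree 0 term absorbs the difference. *)
Lemma comparison_map (F G : free_sequence K n) :
  resolves_quotient I F -> resolves_quotient I G ->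
  exists phi : forall i, 'M_(fr_rank F i, fr_rank G i),
    (forall a b, I ((fr_aug F - phi 0%N *m fr_aug G) a b)) /\
    forall i, fr_map F i *m phi i = phi i.+1 *m fr_map G i.
Proof.
move=> rF rG; have [surG _ exG] := rG; have [_ _ exF] := rF.
have [v hv] := fin_all_exists (fun a => surG (fr_aug F a 0)).
pose phi0 := \matrix_a v a.
have hphi a b : I ((fr_aug F - phi0 *m fr_aug G) a b).
  move: (hv a); rewrite ord1 !mxE; congr (I (_ - _)).
  by apply: eq_bigr => j _; rewrite mxE.
have [|phi [e0 hc]] := @extend_chain_map _ _ F G phi0 exF exG.
  apply: aug_factor => // i j.
  rewrite -mulmxA -[phi0 *m _](subKr (fr_aug F)) mulmxBr -mulmxN.
  apply: ideal_addmx => // {}i {}j; first exact: map_aug_in_ideal.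
  rewrite mulmxN -mulNmx; exact: ideal_mulmx.
by exists phi; rewrite e0.
Qed.

(** Subtracting the identity gives a map inducing 0 on S/I, hence null-homotopic.
    Each term of a homotopy formula contains a factor [fr_map F i], which
    minimality kills modulo the variables. *)
Lemma self_map_const (F : free_sequence K n) (psi : forall i, 'M_(fr_rank F i)) :
  resolves_quotient I F -> minimal_maps F ->
  (forall a b, I ((psi 0%N *m fr_aug F - fr_aug F) a b)) ->
  (forall i, fr_map F i *m psi i = psi i.+1 *m fr_map F i) ->
  forall i, map_mx (mcoeff 0%MM) (psi i) = 1%:M.
Proof.
move=> rF minF h0 hc; have [_ _ exF] := rF.
have min0 i : map_mx (mcoeff 0%MM) (fr_map F i) = 0.
  by apply/matrixP=> a b; rewrite !mxE; apply: minF.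
pose delta i := psi i - 1%:M.
have [|hh0 e0] := @aug_factor F _ (delta 0%N) rF.
  by rewrite /delta mulmxBl mul1mx.
have [|h [eh hh]] := @null_homotopy _ _ F delta hh0 exF _ e0.
  by move=> i; rewrite /delta mulmxBr mulmxBl mulmx1 mul1mx hc.
suff d0 i : map_mx (mcoeff 0%MM) (delta i) = 0.
  move=> i; have := d0 i; rewrite /delta map_mxB map_mx1.
  by move/eqP; rewrite subr_eq0 => /eqP.
case: i => [|i]; first by rewrite e0 map_mxM min0 mulmx0.
by rewrite hh map_mxD !map_mxM !min0 mulmx0 mul0mx addr0.
Qed.

(** Modulo the variables the composite F -> G -> F is an identity matrix that
    factors through a space of dimension [fr_rank G i]. *)
Lemma minimal_rank_le (F G : free_sequence K n) :
  minimal_graded_free_resolution I F -> minimal_graded_free_resolution I G ->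
  forall i, (fr_rank F i <= fr_rank G i)%N.
Proof.
case=> _ rF minF [_ rG _] i.
have [al [al0 alc]] := comparison_map rF rG.
have [be [be0 bec]] := comparison_map rG rF.
have := @self_map_const F (fun i => al i *m be i) rF minF _ _ i.
rewrite map_mxM => e.
rewrite -(mxrank1 K (fr_rank F i)) -e.
- exact: leq_trans (mxrankM_maxl _ _) (rank_leq_col _).
- move=> a b.
  have -> : al 0%N *m be 0%N *m fr_aug F - fr_aug F = (-1)%:M *m
      ((fr_aug F - al 0%N *m fr_aug G) + al 0%N *m (fr_aug G - be 0%N *m fr_aug F)).
    by rewrite mul_scalar_mx scaleN1r mulmxBr subrKA opprB mulmxA.
  apply: ideal_mulmx => // {}a {}b.
  by apply: ideal_addmx => //; apply: ideal_mulmx.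
- by move=> j; rewrite mulmxA alc -!mulmxA bec.
Qed.

(** Any minimal resolution, with its last nonzero rank, computes [cm_type]: the
    rank functions agree, so the last nonzero one is at the same place. *)
Lemma cm_type_eq (F : free_sequence K n) t :
  minimal_graded_free_resolution I F -> last_nonzero_rank F t ->
  cm_type I = t.
Proof.
move=> mF lF; rewrite /cm_type; set P := fun t => _.
have [G [mG [p [ep tp zp]]]] : P (epsilon (inhabits 0%N) P).
  by apply: epsilon_spec; exists t, F.
have [p' [ep' tp' zp']] := lF.
have eqr i : fr_rank F i = fr_rank G i.
  by apply/eqP; rewrite eqn_leq !minimal_rank_le.
have [l|l|e] := ltngtP p p'; last by rewrite -ep -ep' e eqr.
- by move: tp'; rewrite -ep' eqr zp.
- by move: tp; rewrite -ep -eqr zp'.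
Qed.
End MinimalResolutions.

End ChainMaps.

(** * Matrices of forms and linear resolutions *)

Section Cone.
Set Implicit Arguments.
Unset Strict Implicit.
Unset Printing Implicit Defensive.
Local Open Scope ring_scope.

Definition mx_homog (K : fieldType) n (d : nat) r s (A : 'M[{mpoly K[n]}]_(r, s)) :=
  forall i j, A i j \is d.-homog.

Lemma row_mx_homog (K : fieldType) n d r s t
    (A : 'M[{mpoly K[n]}]_(r, s)) (B : 'M_(r, t)) :
  mx_homog d A -> mx_homog d B -> mx_homog d (row_mx A B).
Proof. by move=> hA hB i j; rewrite mxE; case: split => k. Qed.

Lemma col_mx_homog (K : fieldType) n d r s t
    (A : 'M[{mpoly K[n]}]_(r, t)) (B : 'M_(s, t)) :
  mx_homog d A -> mx_homog d B -> mx_homog d (col_mx A B).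
Proof. by move=> hA hB i j; rewrite mxE; case: split => k. Qed.

Lemma mx_homog0 (K : fieldType) n d r s : mx_homog d (0 : 'M[{mpoly K[n]}]_(r, s)).
Proof. by move=> i j; rewrite mxE; apply: dhomog0. Qed.

Lemma mx_homogN (K : fieldType) n d r s (A : 'M[{mpoly K[n]}]_(r, s)) :
  mx_homog d A -> mx_homog d (- A).
Proof. by move=> hA i j; rewrite mxE dhomogN. Qed.

(** Only the degree d part of [p] contributes in degree d + e. *)
Lemma pihomogMr (K : fieldType) n d e (p q : {mpoly K[n]}) :
  q \is e.-homog -> pihomog mdeg (d + e) (p * q) = pihomog mdeg d p * q.
Proof.
move=> hq; rewrite {1}[p]mpolyE [in RHS]pihomogE [in RHS]big_mkcond.
rewrite !mulr_suml linear_sum /=.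
apply: eq_bigr => m _.
have hm : p@_m *: 'X_[m] * q \is (mdeg m + e).-homog.
  by apply: dhomogM => //; apply: dhomogZ; rewrite dhomogX.
case: eqP => [<-|/eqP ne]; first by rewrite pihomog_dE.
by rewrite mul0r; apply: pihomog_ne0 hm; rewrite eqn_add2r.
Qed.

Lemma pihomogMl (K : fieldType) n d e (p q : {mpoly K[n]}) :
  q \is e.-homog -> pihomog mdeg (e + d) (q * p) = q * pihomog mdeg d p.
Proof. by move=> hq; rewrite mulrC addnC pihomogMr // mulrC. Qed.

Lemma map_pihomogM (K : fieldType) n d e r s t
    (A : 'M[{mpoly K[n]}]_(r, s)) (B : 'M_(s, t)) :
  mx_homog e B ->
  map_mx (pihomog mdeg (d + e)) (A *m B) = map_mx (pihomog mdeg d) A *m B.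
Proof.
move=> hB; apply/matrixP=> i j; rewrite !mxE linear_sum /=.
by apply: eq_bigr => k _; rewrite mxE pihomogMr.
Qed.

Lemma map_pihomog_id (K : fieldType) n d r s (A : 'M[{mpoly K[n]}]_(r, s)) :
  mx_homog d A -> map_mx (pihomog mdeg d) A = A.
Proof. by move=> hA; apply/matrixP=> i j; rewrite mxE pihomog_dE. Qed.

(** [F] is read as a resolution of the ideal itself, with [fr_aug] the map
    F_0 -> I, instead of a resolution of S/I. The recursion on ideals is
    uniform in this form, with the unit ideal and the zero ideal included. *)
Definition resolves_ideal (K : fieldType) n (I : {mpoly K[n]} -> Prop)
    (F : free_sequence K n) : Prop :=
  [/\ forall f, I f <-> exists v : 'rV_(fr_rank F 0), f = (v *m fr_aug F) 0 0,
      forall v : 'rV_(fr_rank F 0),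
        v *m fr_aug F = 0 <-> exists w, v = w *m fr_map F 0
    & exact_maps F].

(** The shape of a q-linear resolution of an ideal generated in degree q. *)
Definition linear_sequence (K : fieldType) n (q : nat) (F : free_sequence K n) : Prop :=
  [/\ mx_homog q (fr_aug F), forall i, mx_homog 1 (fr_map F i)
    & forall i (a : 'I_(fr_rank F i)), fr_shift a = (q + i)%:Z].

(** Any lift of the inclusion of ideals, stripped of all but the linear part of
    its entries, is still a lift: the maps of both sequences are homogeneous,
    so the equations hold degree by degree. *)
Lemma linear_comparison (K : fieldType) n (I J : {mpoly K[n]} -> Prop) q
    (F G : free_sequence K n) :
  (forall f, I f -> J f) -> resolves_ideal I F -> resolves_ideal J G ->
  linear_sequence q.+1 F -> linear_sequence q G ->
  exists phi : forall i, 'M_(fr_rank F i, fr_rank G i),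
    [/\ forall i, mx_homog 1 (phi i), fr_aug F = phi 0%N *m fr_aug G &
    forall i, fr_map F i *m phi i = phi i.+1 *m fr_map G i].
Proof.
move=> IJ [surF exF0 exF] [surG exG0 exG] [hF0 hF _] [hG0 hG _].
have [phi0 e0] : exists Y, fr_aug F = Y *m fr_aug G.
  apply: factor_rows => a.
  have /IJ /surG [w hw] : I (fr_aug F a 0).
    by apply/surF; exists (delta_mx 0 a); rewrite -rowE mxE.
  exists w; apply/matrixP=> i j; rewrite !ord1 -hw mxE //.
have [|phi [ephi hc]] := @extend_chain_map _ _ F G phi0 exF exG.
  apply: factor_rows => a; apply/exG0.
  rewrite -row_mul -mulmxA -e0 row_mul; apply/exF0.
  by exists (delta_mx 0 a); rewrite -rowE.
exists (fun i => map_mx (pihomog mdeg 1) (phi i)); split.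
- by move=> i a b; rewrite mxE; apply: pihomogP.
- by rewrite ephi -(map_pihomogM 1 _ hG0) -e0 map_pihomog_id.
- move=> i; rewrite -(map_pihomogM 1 _ (hG i)) -hc.
  apply/matrixP=> a b; rewrite !mxE linear_sum; apply: eq_bigr => k _ /=.
  by rewrite mxE [RHS]pihomogMl //; apply: hF.
Qed.

(** * The mapping cone for a sum of ideals I + x J *)

Section MappingCone.
Variables (K : fieldType) (n q : nat) (F G : free_sequence K n).
Variables (phi : forall i, 'M[{mpoly K[n]}]_(fr_rank F i, fr_rank G i)).
Variable x : {mpoly K[n]}.

(** The third summand of the cone is [F] moved up by one homological degree,
    with the module 0 in degree 0. *)
Definition shifted_rank i : nat := if i is j.+1 then fr_rank F j else 0.

Definition shifted_map i : 'M[{mpoly K[n]}]_(fr_rank F i, shifted_rank i) :=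
  if i is j.+1 then fr_map F j else 0.

(** The degree i term is F_i + G_i + F_(i-1), and (u, v, w) maps to
    (u d + x w, v d - w phi, - w d): the signs make the square of this map 0. *)
Definition cone : free_sequence K n :=
  @FreeSequence K n
    (fun i => fr_rank F i + fr_rank G i + shifted_rank i)%N
    (fun i _ => (q + i)%:Z)
    (fun i => block_mx (block_mx (fr_map F i) 0 0 (fr_map G i)) 0
                       (row_mx x%:M (- phi i)) (- shifted_map i))
    (col_mx (col_mx (fr_aug F) (x *: fr_aug G)) 0).

Lemma cone_map_row i u v (w : 'rV_(fr_rank F i)) :
  row_mx (row_mx u v) w *m fr_map cone i =
  row_mx (row_mx (u *m fr_map F i + x *: w) (v *m fr_map G i - w *m phi i))
         (- (w *m shifted_map i)).
Proof.
rewrite /= mul_row_block mulmx0 add0r mulmxN mul_row_block !mulmx0 add0r addr0.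
by rewrite mul_mx_row add_row_mx mulmxN mul_mx_scalar.
Qed.

Lemma cone_aug_row u v (w : 'rV_(shifted_rank 0)) :
  row_mx (row_mx u v) w *m fr_aug cone = u *m fr_aug F + x *: (v *m fr_aug G).
Proof. by rewrite /= !mul_row_col mulmx0 addr0 scalemxAr. Qed.

Lemma row_mx3P i (P : 'rV[{mpoly K[n]}]_(fr_rank cone i) -> Prop) :
  (forall u v w, P (row_mx (row_mx u v) w)) -> forall v, P v.
Proof.
move=> h v; rewrite -[v](@hsubmxK _ _ _ (shifted_rank i)).
by rewrite -[lsubmx v](@hsubmxK _ _ _ (fr_rank G i)).
Qed.

Variables I J : {mpoly K[n]} -> Prop.
Hypothesis x_neq0 : x != 0.
Hypothesis colonI : forall f, I (x * f) -> I f.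
Hypothesis resF : resolves_ideal I F.
Hypothesis resG : resolves_ideal J G.
Hypothesis phi_aug : fr_aug F = phi 0%N *m fr_aug G.
Hypothesis phi_map : forall i, fr_map F i *m phi i = phi i.+1 *m fr_map G i.

Lemma row_mx3_eq i (u u' : 'rV[{mpoly K[n]}]_(fr_rank F i))
    (v v' : 'rV_(fr_rank G i)) (w w' : 'rV_(shifted_rank i)) :
  row_mx (row_mx u v) w = row_mx (row_mx u' v') w' <->
  [/\ u = u', v = v' & w = w'].
Proof.
split; last by case=> -> -> ->.
by case/eq_row_mx=> /eq_row_mx [-> ->] ->.
Qed.

Lemma scaler_rV_eq0 r (w : 'rV[{mpoly K[n]}]_r) : x *: w = 0 -> w = 0.
Proof.
move=> h; apply/rowP=> j; have /rowP/(_ j) := h; rewrite !mxE.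
by move/eqP; rewrite mulf_eq0 (negPf x_neq0) => /eqP.
Qed.

(** In positive degrees this is exactness of [F]. In degree 0 the augmentation
    kills x w, hence w, since x is not a zero divisor. *)
Lemma shifted_exact i u (w : 'rV_(fr_rank F i)) :
  u *m fr_map F i + x *: w = 0 -> w *m shifted_map i = 0 ->
  exists w', w = w' *m fr_map F i.
Proof.
have [_ exF0 exF] := resF.
case: i u w => [|i] u w; last by move=> _ /exF.
move=> e _; apply/exF0; apply: scaler_rV_eq0.
have -> : x *: (w *m fr_aug F) = (u *m fr_map F 0 + x *: w) *m fr_aug F.
  rewrite mulmxDl (_ : _ *m _ *m _ = 0) ?add0r ?scalemxAl //.
  by apply/exF0; exists u.
by rewrite e mul0mx.
Qed.

Lemma map_shifted_map i : fr_map F i *m shifted_map i = 0.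
Proof.
case: i => [|i]; first by rewrite mulmx0.
by case: resF => _ _ exF; apply: exact_map_comp.
Qed.

Lemma map_aug0 : fr_map F 0 *m fr_aug F = 0.
Proof.
have [_ ex0 _] := resF; apply/row_matrixP=> j; rewrite row_mul row0.
by apply/ex0; exists (delta_mx 0 j); rewrite -rowE.
Qed.

Lemma cone_exact : exact_maps cone.
Proof.
have [_ _ exF] := resF; have [_ _ exG] := resG.
move=> i; elim/row_mx3P => u v w; rewrite cone_map_row; split.
  rewrite -[0]row_mx0 -[X in row_mx X 0]row_mx0 => /row_mx3_eq [eu ev /eqP].
  rewrite oppr_eq0 => /eqP ew.
  (* Once w = w' d, both u + x w' and v - w' phi are cycles. *)
  have [w' hw'] := shifted_exact eu ew; subst w.
  have /exG [v' hv'] : (v - w' *m phi i.+1) *m fr_map G i = 0.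
    by rewrite mulmxBl -!mulmxA -phi_map mulmxA.
  have /exF [u' hu'] : (u + x *: w') *m fr_map F i = 0.
    by rewrite mulmxDl -scalemxAl.
  exists (row_mx (row_mx u' v') (- w')); rewrite cone_map_row; apply/row_mx3_eq.
  by rewrite scalerN !mulNmx !opprK -hu' -hv' addrK subrK.
case; elim/row_mx3P => u' v' w'; rewrite cone_map_row => /row_mx3_eq [-> -> ->].
rewrite -[RHS]row_mx0 -[X in row_mx X 0]row_mx0; apply/row_mx3_eq; split.
- rewrite mulmxDl -mulmxA exact_map_comp // mulmx0 add0r -scalemxAl scalerN.
  by rewrite addrN.
- rewrite mulmxBl -mulmxA exact_map_comp // mulmx0 sub0r !mulNmx opprK.
  by rewrite -!mulmxA phi_map addNr.
- by rewrite mulNmx opprK -mulmxA map_shifted_map mulmx0.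
Qed.

(** Exactness at the last step is where I : x = I enters: a relation
    a + x b = 0 puts b in I, so it comes from the comparison of [F] with [G]. *)
Lemma cone_resolves :
  resolves_ideal (fun f => exists a b, [/\ I a, J b & f = a + x * b]) cone.
Proof.
have [surF exF0 exF] := resF; have [surG exG0 exG] := resG.
split; last exact: cone_exact.
- move=> f; split.
    case=> a [b [/surF [u ->] /surG [v ->] ->]].
    by exists (row_mx (row_mx u v) 0); rewrite cone_aug_row !mxE.
  case; elim/row_mx3P => u v w; rewrite cone_aug_row !mxE => ->.
  exists ((u *m fr_aug F) 0 0), ((v *m fr_aug G) 0 0); split.
  + by apply/surF; exists u.
  + by apply/surG; exists v.
  + by rewrite !mxE.
- elim/row_mx3P => u v w; rewrite cone_aug_row; split; last first.
    case; elim/row_mx3P => u' v' w'; rewrite cone_map_row.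
    move=> /row_mx3_eq [-> -> _].
    rewrite mulmxDl mulmxBl -mulmxA map_aug0 mulmx0 add0r -[w' *m _ *m _]mulmxA.
    rewrite -phi_aug (_ : _ *m _ *m _ = 0) ?sub0r; last first.
      by apply/exG0; exists v'.
    by rewrite -scalemxAl scalerN addrN.
  move=> e.
  (* x times the image of v lies in I, so that image itself does. *)
  have /surF [w' hw'] : I ((v *m fr_aug G) 0 0).
    apply: colonI; apply/surF; exists (- u); rewrite mulNmx.
    by have /eqP := e; rewrite addrC addr_eq0 => /eqP <-; rewrite [RHS]mxE.
  have hw : v *m fr_aug G = w' *m fr_aug F.
    by apply/matrixP=> i j; rewrite !ord1.
  have /exG0 [v' hv'] : (v - w' *m phi 0%N) *m fr_aug G = 0.
    by rewrite mulmxBl -mulmxA -phi_aug hw subrr.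
  have /exF0 [u' hu'] : (u + x *: w') *m fr_aug F = 0.
    by rewrite mulmxDl -scalemxAl -hw.
  exists (row_mx (row_mx u' v') (- w')); rewrite cone_map_row; apply/row_mx3_eq.
  rewrite scalerN !mulNmx !opprK -hu' -hv' addrK subrK; split=> //.
  by apply/matrixP=> ? [].
Qed.
End MappingCone.

Lemma cone_linear (K : fieldType) n q (F G : free_sequence K n)
    (phi : forall i, 'M_(fr_rank F i, fr_rank G i)) (x : {mpoly K[n]}) :
  x \is 1.-homog -> (forall i, mx_homog 1 (phi i)) ->
  linear_sequence q.+1 F -> linear_sequence q G ->
  linear_sequence q.+1 (cone q.+1 phi x).
Proof.
move=> hx hphi [hF0 hF _] [hG0 hG _]; split=> //.
- apply: col_mx_homog; last exact: mx_homog0.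
  apply: col_mx_homog => // i j; rewrite mxE -[q.+1]add1n; exact: dhomogM.
- move=> i; apply: col_mx_homog; apply: row_mx_homog.
  + by apply: col_mx_homog; apply: row_mx_homog => //; apply: mx_homog0.
  + exact: mx_homog0.
  + apply: row_mx_homog; last exact/mx_homogN/hphi.
    by move=> a b; rewrite mxE; case: eqP => // _; apply: dhomog0.
  + apply: mx_homogN; case: i => [|i] /=; [exact: mx_homog0 | exact: hF].
Qed.

(** * From an ideal to its quotient *)

Definition quotient_sequence (K : fieldType) n (F : free_sequence K n) : free_sequence K n :=
  @FreeSequence K n
    (fun i => if i is j.+1 then fr_rank F j else 1%N)
    (fun i => if i is j.+1 then @fr_shift K n F j else fun _ => 0%Z)
    (fun i => if i is j.+1 then fr_map F j else fr_aug F)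
    1%:M.

(** Minimality is a matter of degrees: the generators of the ideal have degree
    at least 1 and the syzygies are linear, so no entry has a constant term. *)
Lemma quotient_resolution (K : fieldType) n (I : {mpoly K[n]} -> Prop) q F :
  I 0 ->
  resolves_ideal I F -> linear_sequence q.+1 F ->
  minimal_graded_free_resolution I (quotient_sequence F).
Proof.
move=> I0 [sur ex0 ex] [h0 h hs].
have const0 d (p : {mpoly K[n]}) : p \is d.+1.-homog -> p@_0%MM = 0.
  by move/dhomog_nemf_coeff; apply; rewrite mf0.
split.
- split=> [[|i] a b m /= hm|a m /=].
  + by rewrite (dhomog_mf (h0 a b) hm) hs addn0 subr0.
  + rewrite (dhomog_mf (h i a b) hm) !hs.
    by rewrite addnS -[(_ + i).+1]addn1 PoszD addrAC subrr add0r.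
  + by rewrite !ord1 mxE eqxx msupp1 inE => /eqP ->; rewrite mdeg0.
- split=> [f|v|[|i] v /=].
  + by exists f%:M; rewrite /= mulmx1 mxE eqxx mulr1n subrr.
  + rewrite /= mulmx1; split=> [/sur [w hw]|[w ->]]; last by apply/sur; exists w.
    by exists w; apply/matrixP=> i j; rewrite !ord1.
  + exact: ex0.
  + exact: ex.
- case=> [|i] a b /=; [exact: const0 (h0 a b) | exact: const0 (h i a b)].
Qed.
End Cone.

(** * Ideals of polynomials with large monomial supports *)

Section SquarefreeVeronese.
Set Implicit Arguments.
Unset Strict Implicit.
Unset Printing Implicit Defensive.
Local Open Scope ring_scope.

Definition support_size n k (m : 'X_{1..n}) : nat :=
  (\sum_(i < n | (i < k)%N) (m i != 0%N))%N.

(** The ideal generated by the square-free monomials of degree q in the first k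
    variables, by the condition on monomials that makes sums and colon ideals
    immediate. *)
Definition support_ideal (K : fieldType) n k q (f : {mpoly K[n]}) : Prop :=
  forall m, m \in msupp f -> (q <= support_size k m)%N.

Lemma support_size_addr n k (m m' : 'X_{1..n}) :
  (support_size k m' <= support_size k (m + m')%MM)%N.
Proof.
apply: leq_sum => i _; rewrite mnmDE addn_eq0 negb_and.
by case: (m' i != _); rewrite ?orbT.
Qed.

Lemma support_sizeS n (k : 'I_n) (m : 'X_{1..n}) :
  support_size k.+1 m = ((m k != 0%N) + support_size k m)%N.
Proof.
rewrite /support_size (bigD1 k) //=; congr (_ + _)%N.
by apply: eq_bigl => i; rewrite ltnS [RHS]ltn_neqAle andbC.
Qed.

(** Variables are numbered from 0, so [k] is the first index that
    [support_size k] ignores. *)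
Lemma support_size_mulX n (k : 'I_n) (m : 'X_{1..n}) :
  support_size k (m + U_(k))%MM = support_size k m.
Proof.
apply: eq_bigr => i ik; rewrite mnmDE mnm1E.
case: (k =P i) => [e|_]; last by rewrite addn0.
by rewrite -e ltnn in ik.
Qed.

Lemma support_ideal_is_ideal (K : fieldType) n k q :
  is_ideal (@support_ideal K n k q).
Proof.
split=> [m|f g hf hg m|c f hf m]; first by rewrite msupp0.
  by move/msuppD_le; rewrite mem_cat => /orP [/hf|/hg].
case/msuppM_le/allpairsP=> -[m1 m2] [_ /= /hf h ->].
exact: leq_trans h (support_size_addr _ _ _).
Qed.

(** The variable x_k does not occur in the generators of the ideal, so it is a
    nonzerodivisor modulo it. *)
Lemma support_ideal_colon (K : fieldType) n (k : 'I_n) q (f : {mpoly K[n]}) :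
  support_ideal k q ('X_k * f) -> support_ideal k q f.
Proof.
move=> h m hm; rewrite -support_size_mulX; apply: h.
by rewrite mulrC addmC mcoeff_msupp mcoeffMX -mcoeff_msupp.
Qed.

Lemma support_idealX (K : fieldType) n k q (m : 'X_{1..n}) c :
  (q <= support_size k m)%N -> support_ideal k q (c *: 'X_[m] : {mpoly K[n]}).
Proof. by move=> h m' /msuppZ_le; rewrite msuppX inE => /eqP ->. Qed.

(** A monomial with q+1 of the first k+1 variables either has q+1 of the first
    k, or is divisible by x_k with q of the first k left over. *)
Lemma support_idealS (K : fieldType) n (k : 'I_n) q (f : {mpoly K[n]}) :
  support_ideal k.+1 q.+1 f <->
  exists a b, [/\ support_ideal k q.+1 a, support_ideal k q b & f = a + 'X_k * b].
Proof.
have [I0 ID _] := @support_ideal_is_ideal K n k q.+1.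
have [J0 JD _] := @support_ideal_is_ideal K n k q.
split=> [hf|[a [b [ha hb ->]]]]; last first.
  have [_ D _] := @support_ideal_is_ideal K n k.+1 q.+1; apply: D => m.
    by move/ha; rewrite support_sizeS => h; apply: leq_trans h (leq_addl _ _).
  rewrite mulrC (perm_mem (msuppMX _ _)) => /mapP [m' /hb h ->].
  by rewrite support_sizeS addmC support_size_mulX mnmDE mnm1E eqxx addn1.
(* The decomposition is additive, so it is enough to sort single terms. *)
rewrite [f]mpolyE big_seq.
apply: (big_ind (fun f => exists a b,
  [/\ support_ideal k q.+1 a, support_ideal k q b & f = a + 'X_k * b])).
- by exists 0, 0; rewrite mulr0 addr0.
- move=> f1 f2 [a1 [b1 [ha1 hb1 ->]]] [a2 [b2 [ha2 hb2 ->]]].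
  exists (a1 + a2), (b1 + b2); split; [exact: ID|exact: JD|].
  by rewrite mulrDr addrACA.
move=> m /hf; rewrite support_sizeS; have [m0|m0] := eqVneq (m k) 0%N => /= h.
  exists (f@_m *: 'X_[m]), 0; rewrite mulr0 addr0; split=> //.
  exact: support_idealX.
have em : (m - U_(k) + U_(k))%MM = m.
  rewrite submK //; apply/mnm_lepP => i.
  by rewrite mnm1E; case: eqP => // <-; rewrite lt0n.
exists 0, (f@_m *: 'X_[m - U_(k)]); split=> //.
  by apply: support_idealX; rewrite -support_size_mulX em.
by rewrite add0r -scalerAr mulrC -mpolyXD em.
Qed.

Lemma ideal_gen_is_ideal (R : comNzRingType) (G : R -> Prop) :
  is_ideal (ideal_gen G).
Proof.
split.
- exists 0%N, (fun=> 0), (fun=> 0); split; first by case.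
  by rewrite big_ord0.
- move=> _ _ [k1 [c1 [g1 [h1 ->]]]] [k2 [c2 [g2 [h2 ->]]]].
  exists (k1 + k2)%N,
    (fun j => match split j with inl i => c1 i | inr i => c2 i end),
    (fun j => match split j with inl i => g1 i | inr i => g2 i end).
  split; first by move=> j; case: (split j).
  rewrite big_split_ord /=; congr (_ + _); apply: eq_bigr => i _.
    by rewrite (unsplitK (inl i)).
  by rewrite (unsplitK (inr i)).
- move=> c _ [k [d [g [h ->]]]]; exists k, (fun j => c * d j), g; split=> //.
  by rewrite mulr_sumr; apply: eq_bigr => i _; rewrite mulrA.
Qed.

Lemma squarefree_divisor n q (m : 'X_{1..n}) :
  (q <= support_size n m)%N ->
  exists m' : 'X_{1..n}, [/\ forall i, (m' i <= 1)%N, mdeg m' = q & (m' <= m)%MM].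
Proof.
move=> h; pose A := [pred i : 'I_n | m i != 0%N]; pose s := take q (enum A).
have us : uniq s by rewrite take_uniq ?enum_uniq.
exists [multinom (i \in s : nat) | i < n]; split.
- by move=> i; rewrite mnmE; case: (_ \in _).
- rewrite mdegE (eq_bigr (fun i => (i \in s : nat))); last by move=> i _; rewrite mnmE.
  rewrite -big_mkcond /= sum1_card (card_uniqP us) size_takel //.
  rewrite -cardE; apply: leq_trans h _; rewrite -sum1_card big_mkcond /=.
  rewrite /support_size big_mkcond /=; apply: leq_sum => i _.
  by rewrite ltn_ord inE; case: (m i != 0%N).
- apply/mnm_lepP => i; rewrite mnmE; case: (boolP (_ \in _)) => // /mem_take.
  by rewrite mem_enum inE lt0n.
Qed.

Lemma squarefree_veroneseP (K : fieldType) n q (f : {mpoly K[n]}) :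
  squarefree_veronese K n q f <-> support_ideal n q f.
Proof.
split.
  case=> k [c [g [hg ->]]].
  apply: ideal_sum (support_ideal_is_ideal _ _ _ _) _ => j.
  have [_ _] := support_ideal_is_ideal K n n q; apply.
  have [m [m1 <- ->]] := hg j; rewrite -[X in support_ideal _ _ X]scale1r.
  apply: support_idealX.
  rewrite mdegE /support_size [leqRHS]big_mkcond /=; apply: leq_sum => i _.
  by rewrite ltn_ord; case: (m i) (m1 i) => [|[]].
have [G0 GD GM] := @ideal_gen_is_ideal _ (@squarefree_monomial K n q).
move=> hf; rewrite [f]mpolyE big_seq /squarefree_veronese.
apply: (big_ind (ideal_gen _)) => // m /hf /squarefree_divisor [m' [m1 mq le]].
rewrite -(submK le) mpolyXD scalerAl; apply: GM.
exists 1%N, (fun=> 1), (fun=> 'X_[m']); split; first by move=> _; exists m'.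
by rewrite big_ord1 mul1r.
Qed.

(** * The linear resolution and its last rank *)

(** For q = 0 the predecessor is truncated, which gives the ranks 1, 0, 0, ...
    of the unit ideal, as the recursion requires. *)
Definition veronese_betti k q i : nat := 'C(k, q + i) * 'C((q + i).-1, i).

(** The three summands are the ranks of the three summands of the cone. *)
Lemma veronese_bettiS k q i :
  veronese_betti k.+1 q.+1 i =
  (veronese_betti k q.+1 i + veronese_betti k q i +
    (if i is j.+1 then veronese_betti k q.+1 j else 0))%N.
Proof.
rewrite /veronese_betti; case: i => [|i].
  by rewrite !addn0 !bin0 !muln1 binS.
rewrite !addSn !addnS /= !binS; lia.
Qed.

Definition unit_sequence (K : fieldType) n : free_sequence K n :=
  @FreeSequence K n (fun i => if i is 0 then 1 else 0)%N (fun i _ => i%:Z)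
    (fun i => 0) 1%:M.

Definition null_sequence (K : fieldType) n q : free_sequence K n :=
  @FreeSequence K n (fun i => 0%N) (fun i _ => (q + i)%:Z) (fun i => 0) 0.

Lemma unit_resolution (K : fieldType) n k :
  [/\ resolves_ideal (@support_ideal K n k 0) (unit_sequence K n),
    linear_sequence 0 (unit_sequence K n)
    & forall i, fr_rank (unit_sequence K n) i = veronese_betti k 0 i].
Proof.
split.
- split=> [f|v|i v] /=.
  + by split=> // _; exists f%:M; rewrite mulmx1 mxE eqxx mulr1n.
  + rewrite mulmx1; split=> [->|[w ->]]; last by rewrite mulmx0.
    by exists 0; rewrite mul0mx.
  + split=> _; last by rewrite mulmx0.
    by exists 0; apply/matrixP=> ? [].
- split=> // [a b|i]; last exact: mx_homog0.
  by rewrite /= mxE !ord1 eqxx; apply: dhomog1.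
- case=> [|i]; rewrite /veronese_betti add0n; first by rewrite !bin0.
  by rewrite [X in _ = (_ * X)%N]bin_small ?muln0.
Qed.

(** Induction on k through the mapping cone; the unit ideal (q = 0) and the zero
    ideal (k = 0 < q) start it. *)
Lemma veronese_resolution (K : fieldType) n k q : (k <= n)%N ->
  exists F : free_sequence K n, [/\ resolves_ideal (support_ideal k q) F,
    linear_sequence q F & forall i, fr_rank F i = veronese_betti k q i].
Proof.
have thin r (A B : 'M[{mpoly K[n]}]_(r, 0)) : A = B.
  by apply/matrixP=> ? [].
elim: k q => [|k IH] [|q] hk.
- by exists (unit_sequence K n); apply: unit_resolution.
- exists (null_sequence K n q.+1); split.
  + split=> [f|v|i v].
    * split=> [h|[v ->]]; last first.
        by rewrite mulmx0 mxE; case: (support_ideal_is_ideal K n 0 q.+1).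
      (* No monomial involves a variable among the first 0. *)
      exists 0; rewrite mul0mx mxE; apply/eqP; rewrite -msupp_eq0.
      case e: (msupp f) => [|m s] //.
      have := h m; rewrite e inE eqxx => /(_ isT).
      by rewrite /support_size big_pred0.
    * by split=> _; [exists 0; apply: thin | rewrite mulmx0].
    * by split=> _; [exists 0; apply: thin | rewrite mulmx0].
  + by split=> // [|i]; apply: mx_homog0.
  + by move=> i; rewrite /veronese_betti bin0n.
- by exists (unit_sequence K n); apply: unit_resolution.
- have [F [rF lF bF]] := IH q.+1 (ltnW hk).
  have [G [rG lG bG]] := IH q (ltnW hk).
  pose x := Ordinal hk : 'I_n.
  have sub f : support_ideal k q.+1 f -> @support_ideal K n k q f.
    by move=> h m /h /ltnW.
  have [phi [hphi phi0 phiS]] := linear_comparison sub rF rG lF lG.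
  exists (cone q.+1 phi 'X_x); split.
  + have x0 : 'X_x != 0 :> {mpoly K[n]} by rewrite -msupp_eq0 msuppX.
    have [s e0 e] :=
      cone_resolves q.+1 x0 (@support_ideal_colon K n x q.+1) rF rG phi0 phiS.
    split=> // f; split; first by move/(@support_idealS K n x q f)/s.
    by move/s/(@support_idealS K n x q f).
  + by apply: cone_linear => //; rewrite dhomogX; apply/eqP; apply: mdeg1.
  + by move=> [|i]; rewrite veronese_bettiS /= !bF bG.
Qed.

End SquarefreeVeronese.

Theorem proposition4p3 (K : fieldType) (n q : nat) (hq1 : (1 <= q)%N)
    (hqn : (q <= n)%N) :
  cm_type (squarefree_veronese K n q) = 'C(n - 1, n - q).
Proof.
case: q hq1 hqn => // q _ hqn.
have [F [[s e0 e] lF bF]] := veronese_resolution K q.+1 (leqnn n).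
have idV : is_ideal (squarefree_veronese K n q.+1) by apply: ideal_gen_is_ideal.
apply: (cm_type_eq idV (F := quotient_sequence F)).
  apply: quotient_resolution lF; first by case: idV.
  split=> // f; split; first by move/squarefree_veroneseP/s.
  by move/s/squarefree_veroneseP.
exists (n - q.+1).+1; split.
- by rewrite /= bF /veronese_betti subnKC // binn mul1n subn1.
- by rewrite bin_gt0 leq_sub2l.
- case=> // i hi; rewrite /= bF /veronese_betti bin_small //.
  lia.
Qed.
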